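(* Let $L$ be a completely distributive lattice, $G$ a group and $\mu\in L(G)$. If $\mu$ satisfies the maximal condition, then every $L$-subgroup of $\mu$ is finitely generated. Conversely, if $L$ is an upper well ordered lattice and every $L$-subgroup of $\mu$ is finitely generated, then $\mu$ satisfies the maximal condition.
   Context: $L$ is a completely distributive lattice with least element $0$, and $G$ is a group. $L$ is upper well ordered if every non-empty subset of $L$ contains its supremum. An $L$-subset of $G$ is a function $G\to L$; $\eta\subseteq\mu$ means $\eta(x)\le\mu(x)$ for all $x\in G$. An $L$-subgroup of $G$ is an $L$-subset $\mu$ with $\mu(xy)\ge\mu(x)\wedge\mu(y)$ and $\mu(x^{-1})=\mu(x)$ for all $x,y\in G$; $L(G)$ is the set of these. For $\mu\in L(G)$, the $L$-subgroups of $\mu$ are the $\eta\in L(G)$ with $\eta\subseteq\mu$. For $a\in L$, $x\in G$, the $L$-point $a_x$ is the $L$-subset with value $a$ at $x$ and $0$ elsewhere; $a_x\in\mu$ means $\mu(x)\ge a$. $\langle {a_1}_{x_1},\dots,{a_n}_{x_n}\rangle$ is the smallest $L$-subgroup of $G$ containing the union (pointwise join) of these $L$-points. An $L$-subgroup $\eta$ of $G$ is finitely generated if $\eta=\langle {a_1}_{x_1},\dots,{a_n}_{x_n}\rangle$ for finitely many $L$-points ${a_i}_{x_i}\in\eta$. $\mu$ satisfies the maximal condition if every non-empty set $S$ of $L$-subgroups of $\mu$ contains a maximal element, i.e. an element of $S$ not properly contained in any other element of $S$. *)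

(* Defs.v *)
From mathcomp Require Import all_boot all_order.
From mathcomp Require Import boolp classical_sets.

Set Implicit Arguments.
Unset Strict Implicit.
Unset Printing Implicit Defensive.

Import Order.TTheory.

Local Open Scope classical_set_scope.
Local Open Scope order_scope.

Definition complete_lattice d (L : tbLatticeType d) : Prop :=
  forall A : set L, supremums A !=set0 /\ infimums A !=set0.

(* In a complete lattice, [supremum \bot A] and [infimum \top A] are the join
   and the meet of every [A], including [A = set0]. *)
Definition completely_distributive d (L : tbLatticeType d) : Prop :=
  complete_lattice L /\
  forall (I : Type) (J : I -> set L),
    infimum \top (range (fun i => supremum \bot (J i))) =
    supremum \bot
      [set infimum \top (range f) | f in [set f : I -> L | forall i, J i (f i)]].

Definition upper_well_ordered d (L : tbLatticeType d) : Prop :=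
  forall A : set L, A !=set0 -> A `&` supremums A !=set0.

Section LSubsets.
Context {d : Order.disp_t} {L : tbLatticeType d} {G : groupType}.

(* L-subsets are functions [G -> L]; inclusion [eta <= mu] is the pointwise
   order that [boolp] puts on function types (see [lefP]). *)
Implicit Types mu eta nu A : G -> L.

Definition Lsubgroup mu : Prop :=
  (forall x y : G, mu x `&` mu y <= mu (x * y)%g) /\
  (forall x : G, mu x^-1%g = mu x).

Definition Lsubgroup_of mu eta : Prop := Lsubgroup eta /\ eta <= mu.

Definition Lpoint (a : L) (x : G) : G -> L :=
  fun y => if y == x then a else \bot.

Definition Lpoint_in (a : L) (x : G) mu : Prop := a <= mu x.

Definition generated_by A eta : Prop :=
  [/\ Lsubgroup eta, A <= eta &
      forall nu, Lsubgroup nu -> A <= nu -> eta <= nu].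

Definition finitely_generated eta : Prop :=
  exists (n : nat) (a : 'I_n -> L) (x : 'I_n -> G),
    (forall i, Lpoint_in (a i) (x i) eta) /\
    generated_by (fun y => \join_(i < n) Lpoint (a i) (x i) y) eta.

Definition maximal_condition mu : Prop :=
  forall S : set (G -> L),
    S !=set0 -> S `<=` [set eta | Lsubgroup_of mu eta] ->
    exists eta, S eta /\ forall nu, S nu -> ~ (eta < nu).

End LSubsets.

(* Main.v *)
Require Import Defs.
From mathcomp Require Import all_boot all_order.
From mathcomp Require Import boolp classical_sets.

(** The proof is the one for subgroups of a group, with pointwise joins in
    place of unions.

    Given the maximal condition and an L-subgroup [eta] of [mu], let [theta] be
    maximal among the finitely generated L-subgroups of [eta]. If
    [theta x < eta x] for some [x], adjoining the single point [eta x] at [x]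
    to the generators of [theta] gives a larger finitely generated L-subgroup
    of [eta] ([finitely_generated_adjoin]); so [theta = eta].

    Conversely, if a non-empty family has no maximal element, dependent choice
    gives a strictly increasing sequence in it. When every non-empty subset of
    [L] contains its supremum, the values of the sequence at a given point of
    [G] reach their supremum at a finite stage ([chain_sup_attained]). This
    makes the pointwise supremum an L-subgroup ([Lsubgroup_chain_sup]), and it
    places any finitely many points of that supremum in a common term of the
    sequence. As finitely many points generate the supremum, the sequence is
    stationary from that term on, a contradiction ([chain_stationary]). *)

Set Implicit Arguments.
Unset Strict Implicit.
Unset Printing Implicit Defensive.

Import Order.TTheory.

Local Open Scope classical_set_scope.
Local Open Scope order_scope.

Section Generation.
Context {d : Order.disp_t} {L : tbLatticeType d} {G : groupType}.
Implicit Types (mu eta nu A : G -> L) (a : L) (x y : G).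

Lemma Lpoint_le a x nu : (Lpoint a x <= nu) <-> Lpoint_in a x nu.
Proof.
split=> [/lefP/(_ x)|axnu]; first by rewrite /Lpoint eqxx.
by apply/lefP => y; rewrite /Lpoint; case: eqP => [->|].
Qed.

(** Reduces every inclusion of a join of L-points to conditions on the single
    points, so that joins of points need no further manipulation. *)
Lemma join_Lpoint_le n (a : 'I_n -> L) (x : 'I_n -> G) nu :
  ((fun y => \join_(i < n) Lpoint (a i) (x i) y) <= nu) <->
  (forall i, Lpoint_in (a i) (x i) nu).
Proof.
split=> [/lefP le_nu i|in_nu].
  apply/Lpoint_le/lefP => y; apply: le_trans (le_nu y).
  exact: (@joins_sup _ _ _ i xpredT (fun j => Lpoint (a j) (x j) y)).
apply/lefP => y; apply/joinsP => i _.
by have /Lpoint_le/lefP := in_nu i; apply.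
Qed.

(** The generated L-subgroup is the pointwise infimum of the L-subgroups that
    contain [A]; it is here that completeness of [L] enters. *)
Lemma generated_by_exists A :
  complete_lattice L -> exists eta, generated_by A eta.
Proof.
move=> completeL.
pose C := [set nu | Lsubgroup nu /\ A <= nu].
have /choice[eta etaP] x : exists b, infimums [set nu x | nu in C] b.
  by case: (completeL [set nu x | nu in C]).
have eta_le nu x : C nu -> eta x <= nu x.
  by move=> Cnu; case: (etaP x) => lb _; apply: lb; exists nu.
have le_eta b x : (forall nu, C nu -> b <= nu x) -> b <= eta x.
  by move=> lb; case: (etaP x) => _; apply=> _ [nu Cnu <-]; exact: lb.
exists eta; split.
- split=> [x y|x].
    apply: le_eta => nu Cnu; have [[nuM _] _] := Cnu.
    exact: le_trans (leI2 (eta_le _ _ Cnu) (eta_le _ _ Cnu)) (nuM x y).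
  apply/le_anti/andP; split; apply: le_eta => nu Cnu;
    have [[_ nuV] _] := Cnu.
    by rewrite -nuV; exact: eta_le.
  by rewrite nuV; exact: eta_le.
- by apply/lefP => x; apply: le_eta => nu [_ /lefP].
- by move=> nu nuL Anu; apply/lefP => x; exact: eta_le.
Qed.

(** The constant [\bot] is generated by the empty family of points. *)
Lemma finitely_generated_bot : finitely_generated (fun _ : G => \bot : L).
Proof.
exists 0, (fun=> \bot), (fun=> 1%g); split; first by case.
split; first by split=> [x y|//]; rewrite meetxx.
- by apply/join_Lpoint_le => -[].
- by move=> nu _ _; apply/lefP => x; exact: le0x.
Qed.

Lemma finitely_generated_adjoin theta eta a x :
    complete_lattice L -> finitely_generated theta ->
    Lsubgroup eta -> theta <= eta -> Lpoint_in a x eta ->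
  exists nu, [/\ finitely_generated nu, Lsubgroup nu, theta <= nu,
                 nu <= eta & Lpoint_in a x nu].
Proof.
move=> completeL [n [b [y [b_theta [_ _ theta_min]]]]] etaL theta_eta a_eta.
pose b' (i : 'I_n.+1) := if unlift ord0 i is Some j then b j else a.
pose y' (i : 'I_n.+1) := if unlift ord0 i is Some j then y j else x.
have [nu nuG] :=
  generated_by_exists (fun z => \join_(i < n.+1) Lpoint (b' i) (y' i) z)
                      completeL.
have [nuL /join_Lpoint_le b'_nu nu_min] := nuG.
exists nu; split=> //.
- by exists n.+1, b', y'.
- apply: theta_min => //; apply/join_Lpoint_le => j.
  by have := b'_nu (lift ord0 j); rewrite /b' /y' liftK.
- apply: nu_min => //; apply/join_Lpoint_le => i; rewrite /b' /y'.
  case: unliftP => [j _|_ //]; apply: le_trans (b_theta j) _.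
  by have /lefP := theta_eta; apply.
- by have := b'_nu ord0; rewrite /b' /y' unlift_none.
Qed.

End Generation.

Section Chains.
Context {d : Order.disp_t} {L : tbLatticeType d} {G : groupType}.
Variable u : nat -> G -> L.
Hypothesis u_mono : {homo u : m n / (m <= n)%N >-> m <= n}.

(** In such an [L], the set of values of the sequence at [x] contains its
    supremum, which is therefore the value [u (N x) x] of some term. *)
Lemma chain_sup_attained : upper_well_ordered L ->
  exists (sup : G -> L) (N : G -> nat),
    (forall n, u n <= sup) /\ (forall x, sup x = u (N x) x).
Proof.
move=> wfL.
have /choice[N N_sup] x : exists N, forall n, u n x <= u N x.
  have [|_ [[N _ <-] [ub _]]] := wfL (range (u^~ x)); first by exists (u 0 x), 0.
  by exists N => n; apply: ub; exists n.
exists (fun x => u (N x) x), N; split=> // n.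
by apply/lefP => x; exact: N_sup.
Qed.

Variables (sup : G -> L) (N : G -> nat).
Hypothesis u_le_sup : forall n, u n <= sup.
Hypothesis sup_attained : forall x, sup x = u (N x) x.

Lemma chain_sup_le n x : (N x <= n)%N -> sup x <= u n x.
Proof. by rewrite sup_attained => /u_mono/lefP. Qed.

Lemma Lsubgroup_chain_sup : (forall n, Lsubgroup (u n)) -> Lsubgroup sup.
Proof.
move=> uL; split=> [x y|x].
  (* Both suprema are attained at the common stage [k]. *)
  pose k := maxn (N x) (N y); have [ukM _] := uL k.
  have /lefP/(_ (x * y)%g) := u_le_sup k; apply: le_trans.
  apply: le_trans (ukM x y).
  by rewrite leI2 // chain_sup_le // ?leq_maxl ?leq_maxr.
have supV z : sup z^-1%g <= sup z.
  by rewrite [sup z^-1%g]sup_attained (uL _).2; have /lefP := u_le_sup (N z^-1%g).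
by apply/le_anti; rewrite supV /= -{1}[x]invgK supV.
Qed.

(** A generator at [x i] lies in [u n] as soon as [n] reaches [N (x i)], so the
    maximum of these finitely many stages serves all generators at once. *)
Lemma chain_stationary : (forall n, Lsubgroup (u n)) ->
  finitely_generated sup -> exists n, sup <= u n.
Proof.
move=> uL [m [a [x [a_sup [_ _ sup_min]]]]].
exists (\max_(i < m) N (x i)); apply: sup_min => //.
apply/join_Lpoint_le => i; apply: le_trans (a_sup i) _.
by apply: chain_sup_le; exact: (leq_bigmax i).
Qed.

End Chains.

(** Iterating a choice function on the subtype of elements of [S] keeps every
    term of the sequence in [S], where the absence of a maximal element can be
    used again. *)
Lemma no_maximal_chain d (T : porderType d) (S : set T) :
    S !=set0 -> ~ (exists t, S t /\ forall s, S s -> ~ (t < s)) ->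
  exists u : nat -> T, (forall n, S (u n)) /\ forall n, u n < u n.+1.
Proof.
move=> [t0 St0] noMax.
have /choice[next nextP] (t : {t | S t}) : exists s : {t | S t}, sval t < sval s.
  apply: contrapT => noNext; apply: noMax; exists (sval t).
  split=> [|s Ss ts]; first exact: svalP.
  by apply: noNext; exists (exist _ s Ss).
pose v n := iter n next (exist _ t0 St0).
by exists (fun n => sval (v n)); split=> n; [exact: svalP | exact: nextP].
Qed.

Theorem theorem4p10 (d : Order.disp_t) (L : tbLatticeType d) (G : groupType)
    (mu : G -> L) (hL : completely_distributive L) (hmu : Lsubgroup mu) :
  (maximal_condition mu ->
     forall eta : G -> L, Lsubgroup_of mu eta -> finitely_generated eta) /\
  (upper_well_ordered L ->
     (forall eta : G -> L, Lsubgroup_of mu eta -> finitely_generated eta) ->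
     maximal_condition mu).
Proof.
split=> [maxc eta [etaL eta_mu]|wfL fg S S0 S_mu].
  pose S := [set theta | [/\ finitely_generated theta, Lsubgroup theta
                           & theta <= eta]].
  have [||theta [[theta_fg thetaL theta_eta] theta_max]] := maxc S.
  - exists (fun=> \bot); split; first exact: finitely_generated_bot.
      by split=> [x y|//]; rewrite meetxx.
    by apply/lefP => x; exact: le0x.
  - by move=> theta [_ thetaL /le_trans/(_ eta_mu)].
  suff -> : eta = theta by [].
  apply/le_anti; rewrite theta_eta andbT; apply/lefP => x.
  have [nu [nu_fg nuL theta_nu nu_eta nu_x]] :=
    finitely_generated_adjoin hL.1 theta_fg etaL theta_eta (lexx (eta x)).
  suff -> : theta = nu by [].
  apply: contrapT => /eqP theta_neq; apply: (theta_max nu) => //.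
  by rewrite lt_neqAle theta_neq.
apply: contrapT => /(no_maximal_chain S0)[u [Su u_lt]].
have u_mono : {homo u : m n / (m <= n)%N >-> m <= n}.
  by apply: homo_leq => [f|f g h|n]; [exact: lexx | exact: le_trans | exact: ltW].
have uL n : Lsubgroup (u n) by have [] := S_mu _ (Su n).
have [sup [N [u_le_sup supE]]] := chain_sup_attained u wfL.
have [|n sup_le] := chain_stationary u_mono supE uL (fg sup _).
  split; first exact: (Lsubgroup_chain_sup u_mono u_le_sup supE uL).
  apply/lefP => x; rewrite supE.
  by have [_ /lefP] := S_mu _ (Su (N x)).
by have := lt_le_trans (u_lt n) (le_trans (u_le_sup _) sup_le); rewrite ltxx.
Qed.
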